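(* For Minimum Spanning Forest in the Late Reject model, the competitive ratio is $1$; that is, there is a strictly $1$-competitive online algorithm in this model (so $\mathrm{ALG}(\sigma)=\mathrm{OPT}(\sigma)$ for every input $\sigma$), and for every real $c<1$ no online algorithm in this model is $c$-competitive.
   Context: Online Minimum Spanning Forest (edge arrival). An input $\sigma$ is a finite simple undirected graph $G=(V,E)$ with a weight function $w\colon E\to\mathbb{R}^+$ and an ordering of its edges. Edges arrive one by one in this order with their weights; endpoints not seen before are revealed with the edge. All online algorithms are deterministic: each decision depends only on the part of the input revealed so far. After each arrival has been processed, the set of currently accepted edges must be a spanning forest of the graph revealed so far, i.e., it must form a spanning tree on each connected component of that graph. $\mathrm{ALG}(\sigma)$ is the total weight of the accepted edges at the end of the input, and $\mathrm{OPT}(\sigma)$ is the minimum total weight of a spanning forest of $G$; the objective is minimization. Late Reject model: upon arrival of an edge the algorithm either accepts or rejects it; in addition, in any step it may remove (late-reject) any previously accepted edges. Any rejection (at arrival or late) is irrevocable, i.e., a rejected edge can never be accepted afterwards. An algorithm $\mathrm{ALG}$ is $c$-competitive if there is a constant $\alpha$ such that $\mathrm{ALG}(\sigma)\le c\,\mathrm{OPT}(\sigma)+\alpha$ for all inputs $\sigma$; it is strictly $c$-competitive if this holds with $\alpha=0$. By convention, ''the competitive ratio is $c$'' includes that the upper bound holds for the strict competitive ratio and the lower bound for the (non-strict) competitive ratio. *)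

(* Defs.v *)
(* MathComp world, with finmap and the reals of MathComp-Analysis. *)
From HB Require Import structures.
From mathcomp Require Import all_boot all_order all_algebra finmap.
From mathcomp Require Import boolp classical_sets reals.

Set Implicit Arguments.
Unset Strict Implicit.
Unset Printing Implicit Defensive.

Import Order.TTheory GRing.Theory Num.Theory.
Local Open Scope fset_scope.
Local Open Scope ring_scope.

(* Vertex names are natural numbers, so that one algorithm, which does not know
   the graph in advance, can run on all finite graphs. An undirected edge is the
   set of its two endpoints. *)
Definition vertex := nat.
Definition edge := {fset vertex}.

Record graph := Graph { vertices : {fset vertex}; edges : {fset edge} }.

Definition simple_graph (G : graph) : Prop :=
  forall e, e \in edges G -> e `<=` vertices G /\ #|` e| = 2%N.

Definition adj (E : {fset edge}) : rel vertex := fun u v => [fset u; v] \in E.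

Definition connected_by (E : {fset edge}) (u v : vertex) : Prop :=
  exists2 p, path (adj E) u p & last u p = v.

Definition component (G : graph) (C : {fset vertex}) : Prop :=
  exists2 u, u \in vertices G &
    forall v, v \in C <-> v \in vertices G /\ connected_by (edges G) u v.

(* Closed walks of length 2 along a single edge are not cycles. *)
Definition acyclic (E : {fset edge}) : Prop :=
  forall c : seq vertex, (2 < size c)%N -> uniq c -> ~ cycle (adj E) c.

Definition is_tree (G : graph) : Prop :=
  [/\ vertices G != fset0,
      forall u v, u \in vertices G -> v \in vertices G ->
        connected_by (edges G) u v
    & acyclic (edges G)].

Definition spanning_forest (G : graph) (F : {fset edge}) : Prop :=
  F `<=` edges G /\
  forall C, component G C -> is_tree (Graph C [fset e in F | e `<=` C]).

(* [order] lists every edge once, in order of arrival. [vset] may contain isolated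
   vertices, which are never revealed. Values of [weight] off the edges are
   irrelevant: see [arrivals]. *)
Record input (R : realType) := Input {
  vset : {fset vertex};
  order : seq edge;
  weight : edge -> R;
  order_uniq : uniq order;
  input_simple : simple_graph (Graph vset [fset e in order]);
  weight_gt0 : forall e, e \in order -> 0 < weight e }.

Definition input_graph (R : realType) (sigma : input R) : graph :=
  Graph (vset sigma) [fset e in order sigma].

Definition arrivals (R : realType) (sigma : input R) : seq (edge * R) :=
  [seq (e, weight sigma e) | e <- order sigma].

Definition revealed_graph (R : realType) (s : seq (edge * R)) : graph :=
  Graph (\bigcup_(x <- s) x.1) [fset e in unzip1 s].

Record decision := Decision { accept : bool; late_reject : {fset edge} }.

(* The argument is the sequence revealed so far, ending with the edge to decide
   on. Earlier decisions need not be passed: they are determined by it. *)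
Definition algorithm (R : realType) := seq (edge * R) -> decision.

(* Only the arriving edge can enter the accepted set, and edges arrive once, so
   every rejection is irrevocable. *)
Definition step (d : decision) (e : edge) (acc : {fset edge}) : {fset edge} :=
  (acc `\` late_reject d) `|` (if accept d then [fset e] else fset0).

Fixpoint run (R : realType) (A : algorithm R) (past : seq (edge * R))
    (acc : {fset edge}) (future : seq (edge * R)) : {fset edge} :=
  if future is x :: s then
    let past' := rcons past x in run A past' (step (A past') x.1 acc) s
  else acc.

Definition accepted (R : realType) (A : algorithm R) (s : seq (edge * R)) :
  {fset edge} := run A [::] fset0 s.

Definition online_algorithm (R : realType) (A : algorithm R) : Prop :=
  forall (sigma : input R) (k : nat), (k <= size (arrivals sigma))%N ->
    let s := take k (arrivals sigma) in
    spanning_forest (revealed_graph s) (accepted A s).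

Definition total_weight (R : realType) (sigma : input R) (F : {fset edge}) : R :=
  \sum_(e <- F) weight sigma e.

Definition ALG (R : realType) (A : algorithm R) (sigma : input R) : R :=
  total_weight sigma (accepted A (arrivals sigma)).

(* The infimum of a nonempty finite set, hence a minimum. *)
Definition OPT (R : realType) (sigma : input R) : R :=
  inf [set total_weight sigma F | F in spanning_forest (input_graph sigma)]%classic.

Definition competitive_with (R : realType) (A : algorithm R) (c alpha : R) : Prop :=
  forall sigma : input R, ALG A sigma <= c * OPT sigma + alpha.

Definition competitive (R : realType) (A : algorithm R) (c : R) : Prop :=
  exists alpha : R, competitive_with A c alpha.

Definition strictly_competitive (R : realType) (A : algorithm R) (c : R) : Prop :=
  competitive_with A c 0.

(* Main.v *)
(* Order edges by weight, with a fixed tie-break. The minimum spanning forest of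
   an edge set E consists of the edges whose ends are not connected by smaller
   edges of E. This condition only gets harder to satisfy as E grows, so an edge
   that leaves the forest never has to come back: dropping such edges as they
   appear is a legal late-reject strategy, and it keeps the forest minimum. For
   the lower bound, on a graph with a single edge of weight W every algorithm and
   OPT both pay W, and W is arbitrary. *)
Require Import Defs.
From mathcomp Require Import all_boot all_order all_algebra finmap.
From mathcomp Require Import boolp classical_sets reals.

Import Order.TTheory GRing.Theory Num.Theory.
Local Open Scope ring_scope.
Local Open Scope fset_scope.

Set Implicit Arguments.
Unset Strict Implicit.
Unset Printing Implicit Defensive.

(** * Walks and connectivity in edge sets *)

Lemma card_edge2 (e : edge) :
  #|` e| = 2%N -> exists u v, u != v /\ e = [fset u; v].
Proof.
move=> e2; have /fset0Pn[u ue] : e != fset0 by rewrite -cardfs_eq0 e2.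
have : #|` e `\ u| == 1%N.
  by move: e2; rewrite (cardfsD1 u) ue add1n => /succn_inj/eqP.
move=> /cardfs1P[v ev]; exists u, v; rewrite -ev fsetD1K //; split=> //.
by have := fset11 v; rewrite -ev !inE eq_sym => /andP[].
Qed.

Lemma adj_sym E : symmetric (adj E).
Proof. by move=> u v; rewrite /adj fsetUC. Qed.

Lemma sub_adj E E' : E `<=` E' -> subrel (adj E) (adj E').
Proof. by move=> sEE' u v; apply: (fsubsetP sEE'). Qed.

Lemma connected_by_refl E u : connected_by E u u.
Proof. by exists [::]. Qed.

Lemma connected_by_trans E u v w :
  connected_by E u v -> connected_by E v w -> connected_by E u w.
Proof.
move=> [p Ep <-] [q Eq <-]; exists (p ++ q); first by rewrite cat_path Ep.
by rewrite last_cat.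
Qed.

Lemma connected_by_adj E u v : adj E u v -> connected_by E u v.
Proof. by move=> Euv; exists [:: v] => //=; rewrite Euv. Qed.

Lemma connected_by_bind E E' u v :
    (forall a b, adj E a b -> connected_by E' a b) ->
  connected_by E u v -> connected_by E' u v.
Proof.
move=> EE' [p Ep <-]; elim: p u Ep => [|a p IHp] u /=.
  by move=> _; apply: connected_by_refl.
by move=> /andP[/EE' E'ua /IHp]; apply: connected_by_trans.
Qed.

Lemma connected_by_sub E E' u v :
  E `<=` E' -> connected_by E u v -> connected_by E' u v.
Proof.
move=> sEE'; apply: connected_by_bind => a b Eab.
exact/connected_by_adj/(sub_adj sEE').
Qed.

Lemma connected_by_sym E u v : connected_by E u v -> connected_by E v u.
Proof.
move=> [p Ep <-]; elim: p u Ep => [|a p IHp] u /=.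
  by move=> _; apply: connected_by_refl.
move=> /andP[Eua /IHp]/connected_by_trans; apply.
by apply: connected_by_adj; rewrite adj_sym.
Qed.

Lemma connected_by_ends E u v a b :
  [fset u; v] = [fset a; b] -> connected_by E a b -> connected_by E u v.
Proof.
move=> uv_ab Eab; have := fset22 u v; have := fset21 u v; rewrite uv_ab !inE.
case/orP=> /eqP ua; case/orP=> /eqP vb; rewrite ua vb //.
- exact: connected_by_refl.
- exact: connected_by_sym.
- exact: connected_by_refl.
Qed.

Lemma connected_by_fsetU1 E e u v :
    connected_by (e |` E) u v ->
  connected_by E u v \/
  exists a b, [/\ e = [fset a; b], connected_by E u a & connected_by E b v].
Proof.
move=> [p Ep <-]; elim: p u Ep => [|x p IHp] u /=.
  by left; apply: connected_by_refl.
case/andP; rewrite {1}/adj in_fset1U => /orP[/eqP def_e|Eux] /IHp IH.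
  case: IH => [Exv|[a [b [eab Exa Ebv]]]].
    by right; exists u, x; split=> //; apply: connected_by_refl.
  (* A second use of [e] can be cut out: [u] is an end of [e], so either the walk restarts at [b]
     without [e], or it crosses [e] once from [a = u]. *)
  have : u \in [fset a; b] by rewrite -eab -def_e !inE eqxx.
  rewrite !inE => /orP[]/eqP ->; last by left.
  by right; exists a, b; split=> //; apply: connected_by_refl.
case: IH => [Exv|[a [b [eab Exa Ebv]]]].
  by left; apply: connected_by_trans Exv; apply: connected_by_adj.
right; exists a, b; split=> //; apply: connected_by_trans Exa.
exact: connected_by_adj.
Qed.

(* Adding the edges of s to L one at a time, some edge is the first to connect
   u and v. *)
Lemma connecting_edge (L : {fset edge}) (s : seq edge) u v :
    connected_by (L `|` [fset e in s]) u v -> ~ connected_by L u v ->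
  exists f F, [/\ f \in s, f \notin F, F `<=` L `|` [fset e in s],
    ~ connected_by F u v & connected_by (f |` F) u v].
Proof.
elim: s => [|f s IHs] Ls nL.
  by case: nL; apply: connected_by_sub Ls; apply/fsubsetP => x; rewrite !inE orbF.
have fLs : f |` (L `|` [fset e in s]) = L `|` [fset e in f :: s].
  by apply/fsetP => x; rewrite !inE orbCA.
have [Lsuv|nLsuv] := EM (connected_by (L `|` [fset e in s]) u v).
  have [g [F [gs gF sF nF gFuv]]] := IHs Lsuv nL.
  exists g, F; split=> //; first by rewrite inE gs orbT.
  by apply: (fsubset_trans sF); rewrite -fLs fsubsetU1.
exists f, (L `|` [fset e in s]); rewrite fLs; split=> //.
- by rewrite inE eqxx.
- apply/negP => fin; apply: nLsuv; apply: connected_by_sub Ls.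
  by rewrite -fLs fsubUset fsub1set fin fsubset_refl.
- by rewrite -fLs fsubsetU1.
Qed.

(** The path itself avoids the closing edge: it meets [x] only at its start, and its first step does
    not lead to [last x p] because [p] has at least two vertices. *)
Lemma cycle_connected_by (E : {fset edge}) x p :
    uniq (x :: p) -> (1 < size p)%N -> path (adj E) x p ->
  connected_by (E `\ [fset last x p; x]) x (last x p).
Proof.
case: p => [|y [|z q]] //= /and3P[xp yq _] _ /andP[Exy Eq].
exists [:: y, z & q] => //=; apply/andP; split.
  rewrite /adj in_fsetD1 [X in _ && X]Exy andbT; apply/eqP => /fsetP/(_ y).
  rewrite !inE eqxx orbT => /esym/orP[]/eqP yx.
    by move: yq; rewrite yx mem_last.
  by move: xp; rewrite yx mem_head.
have allP : all (predC1 x) [:: y, z & q].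
  by apply/allP => a aP /=; apply: contraNneq xp => <-.
apply: (sub_in_path (P := predC1 x) (e := adj E) _ allP) Eq.
move=> a b ax bx Eab; rewrite /adj in_fsetD1 [X in _ && X]Eab andbT.
apply/eqP => /fsetP/(_ x); rewrite !inE eqxx orbT.
by rewrite ![x == _]eq_sym (negPf ax) (negPf bx).
Qed.

(** * The minimum spanning forest for an ordering of the edges by keys *)

Section Kruskal.
Context {d : Order.disp_t} {T : orderType d}.
Implicit Types (key : edge -> T) (E F : {fset edge}) (e f : edge).

Definition lighter key E e := [fset f in E | (key f < key e)%O].

(** The result of the greedy algorithm without a greedy run: an edge is tested against all lighter
    edges, not only the kept ones, so the forests of different edge sets can be compared
    directly. *)
Definition kruskal key E := [fset e in E |
  `[< forall u v, e = [fset u; v] -> ~ connected_by (lighter key E e) u v >]].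

Lemma kruskal_sub key E : kruskal key E `<=` E.
Proof. by apply/fsubsetP => e; rewrite !inE => /andP[]. Qed.

Lemma lighterS key E E' e : E `<=` E' -> lighter key E e `<=` lighter key E' e.
Proof.
move=> /fsubsetP sEE'; apply/fsubsetP => f; rewrite !inE => /andP[/sEE' -> ->].
by [].
Qed.

Lemma card_lighter_lt key E e f : f \in E -> (key f < key e)%O ->
  (#|` lighter key E f| < #|` lighter key E e|)%N.
Proof.
move=> fE lt_fe; apply/fproper_ltn_card/andP; split; apply/fsubsetP.
  by move=> g; rewrite !inE => /andP[-> /lt_trans]; apply.
by move/(_ f); rewrite !inE ltxx andbF fE => /(_ lt_fe).
Qed.

(** A smaller edge set has fewer lighter edges, hence fewer connections. Read backwards, an edge
    once dropped stays out of all later forests. *)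
Lemma kruskal_stable key E E' e :
  E `<=` E' -> e \in E -> e \in kruskal key E' -> e \in kruskal key E.
Proof.
move=> sEE' eE; rewrite !inE /= => /andP[_ /asboolP nc]; rewrite eE.
apply/asboolP => u v /nc n cE; apply: n; apply: connected_by_sub cE.
exact: lighterS.
Qed.

Lemma eq_kruskal key key' E :
  {in E, key =1 key'} -> kruskal key E = kruskal key' E.
Proof.
move=> eqk; apply/fsetP => e; rewrite !inE; case eE: (e \in E) => //=.
suff -> : lighter key E e = lighter key' E e by [].
apply/fsetP => f; rewrite !inE; case fE: (f \in E) => //=.
by rewrite !eqk.
Qed.

(** A dropped edge is bypassed by lighter edges, and these are kept or bypassed in turn; the
    induction is on the number of lighter edges. *)
Lemma kruskal_connected_by key E u v :
  connected_by E u v -> connected_by (kruskal key E) u v.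
Proof.
apply: connected_by_bind => {u v} u v.
have [n] := ubnP #|` lighter key E [fset u; v]|.
elim: n u v => // n IHn u v; rewrite ltnS => len Euv.
have [Kuv|] := boolP ([fset u; v] \in kruskal key E).
  exact: connected_by_adj.
rewrite !inE /= [X in X && _]Euv /= => /asboolPn/existsNP[a]/existsNP[b].
move=> /not_implyP[uvab /contrapT cab].
apply: (connected_by_ends uvab); apply: connected_by_bind cab => x y.
rewrite /adj !inE => /andP[Exy ltxy].
by apply: IHn => //; apply: leq_trans len; apply: card_lighter_lt.
Qed.

(* The ends of the largest edge of a cycle are connected by the rest of it. *)
Lemma acyclic_kruskal key E : injective key -> acyclic (kruskal key E).
Proof.
move=> key_inj c c_gt2 c_uniq Kc.
(* Each edge of the cycle is indexed by its head; [x] is the head of the one with the largest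
   key. *)
have [x xc xmax] : exists2 x, x \in c &
    forall y, y \in c -> (key [fset prev c y; y] <= key [fset prev c x; x])%O.
  have i0 : 'I_(size c) by exists 0%N; apply: leq_trans c_gt2.
  pose g (i : 'I_(size c)) := key [fset prev c (nth 0%N c i); nth 0%N c i].
  have [i _ imax] := @Order.TotalTheory.arg_maxP _ _ _ i0 predT g isT.
  exists (nth 0%N c i); first exact: mem_nth.
  move=> y yc; have yi : (index y c < size c)%N by rewrite index_mem.
  by have := imax (Ordinal yi) isT; rewrite /g /= nth_index.
have Kx : [fset prev c x; x] \in kruskal key E by apply: prev_cycle Kc xc.
pose L := [fset f in kruskal key E | (key f <= key [fset prev c x; x])%O].
have Lc : cycle (adj L) c.
  apply: cycle_from_prev => // y yc; have := prev_cycle Kc yc.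
  by rewrite /adj !inE /= xmax // andbT.
(* Rotating the cycle to start at [x] makes the largest edge its closing edge. *)
have [i p cE] := rot_to xc.
have prevx : prev c x = last x p.
  have := cycle_prev c_uniq; rewrite -(rot_cycle i) cE /= rcons_path.
  by case/andP=> _ /eqP.
move: Kx Lc c_gt2 c_uniq.
rewrite -(rot_cycle i) -(size_rot i c) -(rot_uniq i) cE.
rewrite /= rcons_path => Kx /andP[Lp _] p_gt1 xp_uniq.
have := cycle_connected_by xp_uniq p_gt1 Lp; rewrite -prevx => cL.
move: Kx; rewrite !inE => /andP[_ /asboolP/(_ _ _ erefl)]; apply.
apply/connected_by_sym; apply: connected_by_sub cL.
apply/fsubsetP => f; rewrite !inE => /andP[neqf /andP[/andP[-> _] lef]] /=.
by rewrite lt_neqAle lef andbT; apply: contra neqf => /eqP/key_inj ->.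
Qed.

(* F need not be acyclic. As long as some forest edge e is missing from F, an edge
   f of F above e can be exchanged for e, which lowers the total rank of F. *)
Lemma kruskal_optimal (R : realDomainType) (w : edge -> R) key E F :
    injective key -> (forall e f, (key e <= key f)%O -> w e <= w f) ->
    (forall e, e \in E -> #|` e| = 2%N) -> (forall e, e \in E -> 0 <= w e) ->
    F `<=` E -> (forall u v, adj E u v -> connected_by F u v) ->
  \sum_(e <- kruskal key E) w e <= \sum_(e <- F) w e.
Proof.
move=> key_inj key_w E2 w_ge0.
have [n] := ubnP (\sum_(e <- F) #|` lighter key E e|)%N.
elim: n F => // n IHn F; rewrite ltnS => leFn sFE cF.
have [sKF|/fsubsetPn[e Ke eF]] := boolP (kruskal key E `<=` F).
  rewrite [leRHS](big_fsetID _ (mem (kruskal key E))) /=.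
  have -> : [fset x in F | x \in kruskal key E] = kruskal key E.
    apply/fsetP => x; rewrite in_fset inE /= andb_idl //.
    exact: (fsubsetP sKF).
  rewrite lerDl big_seq sumr_ge0 // => x; rewrite !inE => /andP[xF _].
  exact/w_ge0/(fsubsetP sFE).
have eE := fsubsetP (kruskal_sub key E) e Ke.
have [u [v def_e]] : exists u v, e = [fset u; v].
  by have [u [v []]] := card_edge2 (E2 e eE); exists u, v.
have ncL : ~ connected_by (lighter key F e) u v.
  move: Ke; rewrite !inE => /andP[_ /asboolP/(_ _ _ def_e) nc] cL; apply: nc.
  by apply: connected_by_sub cL; apply: lighterS.
(* The edges of [F] below [e] do not connect its ends, but all of [F] does, so some edge [f] not
   below [e] completes the connection; this is the edge to exchange. *)
have FE : F = lighter key F e `|` [fset f in [seq f <- F | (key e <= key f)%O]].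
  apply/fsetP => f; rewrite !inE /= mem_filter andbC -andb_orl.
  by rewrite leNgt orbN.
have := cF u v; rewrite /adj -def_e => /(_ eE); rewrite {1}FE.
move=> /connecting_edge/(_ ncL)[f [F0 []]]; rewrite mem_filter -FE.
move=> /andP[le_ef fF] fF0 sF0F nF0 cfF0.
have lt_ef : (key e < key f)%O.
  rewrite lt_neqAle le_ef andbT; apply: contraNneq eF => /key_inj ->.
  exact: fF.
have eFf : e \notin F `\ f by rewrite !inE (negPf eF) andbF.
apply: (@le_trans _ _ (\sum_(g <- e |` (F `\ f)) w g)); last first.
  by rewrite big_fsetU1 //= [leRHS](big_fsetD1 f) //= lerD2r key_w.
apply: IHn.
- apply: leq_trans leFn; rewrite big_fsetU1 //= [X in (_ < X)%N](big_fsetD1 f) //=.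
  by rewrite ltn_add2r card_lighter_lt.
- by rewrite fsubUset fsub1set eE (fsubset_trans _ sFE) // fsubsetDl.
have sF0 : F0 `<=` e |` (F `\ f).
  apply/fsubsetP => g gF0; rewrite !inE (fsubsetP sF0F) // andbT.
  by rewrite (contraNneq _ fF0) ?orbT // => <-.
have [] // := connected_by_fsetU1 cfF0.
move=> [a [b [def_f ua bv]]].
(* The detour replacing [f] goes from [a] to [u], across [e], and from [v] to [b]; its outer pieces
   lie in [F0], which avoids [f]. *)
have ab : connected_by (e |` (F `\ f)) a b.
  apply: (@connected_by_trans _ _ u).
    by apply: connected_by_sym; apply: connected_by_sub ua.
  apply: (@connected_by_trans _ _ v).
    by apply: connected_by_adj; rewrite /adj -def_e !inE eqxx.
  by apply: connected_by_sym; apply: connected_by_sub bv.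
move=> x y /cF; apply: connected_by_bind => x' y' Fxy.
have [xyf|xyf] := eqVneq [fset x'; y'] f; last first.
  by apply: connected_by_adj; rewrite /adj !inE xyf [X in _ || X]Fxy orbT.
by apply: (@connected_by_ends _ _ _ a b); rewrite ?xyf.
Qed.

End Kruskal.

(** * Spanning forests of a graph *)

Lemma spanning_forest_adj G F u v :
    simple_graph G -> spanning_forest G F ->
  adj (edges G) u v -> connected_by F u v.
Proof.
move=> G_simple [_ treeF] Guv; have [uvG _] := G_simple _ Guv.
move: uvG; rewrite fsubUset !fsub1set => /andP[uG vG].
(* Both ends lie in the component of [u], on which [F] is a tree and so connects them. *)
pose C := [fset x in vertices G | `[< connected_by (edges G) u x >]].
have /treeF[_ cC _] : component G C.
  exists u => // x; rewrite !inE; split.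
    by case/andP=> xG /asboolP.
  by case=> xG /asboolP; rewrite /= xG.
apply: (@connected_by_sub [fset e in F | e `<=` C]).
  by apply/fsubsetP => e; rewrite !inE => /andP[].
apply: cC; rewrite !inE /= ?uG ?vG; apply/asboolP.
  exact: connected_by_refl.
exact: connected_by_adj.
Qed.

Lemma spanning_forest_kruskal {d : Order.disp_t} {T : orderType d}
    (key : edge -> T) G :
    injective key -> simple_graph G ->
  spanning_forest G (kruskal key (edges G)).
Proof.
move=> key_inj G_simple; split; first exact: kruskal_sub.
move=> C [r rG compC]; split=> /=.
- apply/fset0Pn; exists r; apply/compC; split=> //.
  exact: connected_by_refl.
- move=> u v uC vC; have [uG ru] := (compC u).1 uC; have [vG rv] := (compC v).1 vC.
  have : connected_by (kruskal key (edges G)) u v.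
    apply: kruskal_connected_by; apply: connected_by_trans rv.
    exact: connected_by_sym.
  (* Only forest edges inside [C] may be used, so the walk is followed step by step to see that it
     never leaves [C]. *)
  case=> p; elim: p u uC uG ru => [|x p IHp] u uC uG ru /=.
    by move=> _ <-; apply: connected_by_refl.
  case/andP=> Kux Kp last_v.
  have Gux : adj (edges G) u x by apply: sub_adj Kux; apply: kruskal_sub.
  have xG : x \in vertices G.
    by have [+ _] := G_simple _ Gux; rewrite fsubUset !fsub1set => /andP[].
  have rx : connected_by (edges G) r x.
    by apply: (connected_by_trans ru); apply: connected_by_adj.
  have xC : x \in C by apply/compC.
  apply: connected_by_trans (IHp x xC xG rx Kp last_v).
  apply: connected_by_adj; rewrite /adj in_fset inE /= [X in X && _]Kux.
  by rewrite fsubUset !fsub1set uC.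
- move=> c c_gt2 c_uniq Kc; apply: (acyclic_kruskal (E := edges G) key_inj c_gt2 c_uniq).
  apply: sub_cycle Kc; apply: sub_adj.
  by apply/fsubsetP => e; rewrite in_fset inE => /andP[].
Qed.

(** [F] must join the two ends of [e], and the first step of a walk between them can only be [e]. *)
Lemma spanning_forest_edge (e : edge) V F :
    simple_graph (Graph V [fset e]) -> spanning_forest (Graph V [fset e]) F ->
  F = [fset e].
Proof.
move=> G_simple sfF; apply/eqP; rewrite eqEfsubset; case: (sfF) => -> _ /=.
rewrite fsub1set; have [_ /card_edge2[u [v [uDv def_e]]]] := G_simple e (fset11 e).
have Guv : adj (edges (Graph V [fset e])) u v by rewrite /adj -def_e fset11.
have [[|x p] /= Fp last_v] := spanning_forest_adj G_simple sfF Guv.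
  by rewrite last_v eqxx in uDv.
case/andP: Fp => Fux _; case: sfF => /fsubsetP/(_ _ Fux) /=.
by rewrite inE => /eqP <-.
Qed.

(** * The online algorithm and its optimality *)

Section Online.
Variable R : realType.
Implicit Types (w : edge -> R) (s t : seq edge) (sigma : input R).

(* Ties are broken by a fixed enumeration of all possible edges, so the relative
   order of two edges does not depend on the input. *)
Definition edge_key w (e : edge) : R *l nat :=
  (w e, choice.pickle e).

Lemma edge_key_inj w : injective (edge_key w).
Proof. by move=> e f [_] /(pcan_inj (@choice.pickleK _)). Qed.

Lemma edge_key_le w e f : (edge_key w e <= edge_key w f)%O -> w e <= w f.
Proof. by rewrite leEprodlexi => /andP[]. Qed.

Definition weighted w s := [seq (e, w e) | e <- s].

Lemma unzip1_weighted w s : unzip1 (weighted w s) = s.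
Proof. by rewrite /unzip1 -map_comp map_id. Qed.

(** Unrevealed edges get the default 0; by [eq_kruskal] the forest of the revealed edges does not
    depend on it. *)
Definition revealed_weight (r : seq (edge * R)) (e : edge) : R :=
  nth 0 (unzip2 r) (index e (unzip1 r)).

Lemma revealed_weightE w s e : e \in s -> revealed_weight (weighted w s) e = w e.
Proof.
move=> es; rewrite /revealed_weight unzip1_weighted /unzip2 -map_comp.
by rewrite (nth_map e) ?index_mem //= nth_index.
Qed.

(** The forest is recomputed from all that is revealed. The arriving edge is the last one, with
    [fset0] as filler for the empty sequence; the late rejects include edges already gone, whose
    removal changes nothing. *)
Definition kruskal_algorithm : algorithm R := fun r =>
  let E := [fset e in unzip1 r] in
  let K := kruskal (edge_key (revealed_weight r)) E in
  Decision (last fset0 (unzip1 r) \in K) (E `\` K).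

(** The invariant is that the accepted set is the forest of the edges seen. By [kruskal_stable], the
    new forest consists of old forest edges and possibly the arriving edge. *)
Lemma run_kruskal w s t :
  run kruskal_algorithm (weighted w s) (kruskal (edge_key w) [fset e in s])
    (weighted w t) = kruskal (edge_key w) [fset e in s ++ t].
Proof.
elim: t s => [|x t IHt] s /=; first by rewrite cats0.
rewrite -map_rcons -cat_rcons -IHt; congr run.
rewrite /step /= unzip1_weighted last_rcons.
set E' := [fset e in rcons s x].
rewrite (@eq_kruskal _ _ _ (edge_key w)); last first.
  move=> e; rewrite in_fset => es.
  by rewrite /edge_key revealed_weightE.
set K' := kruskal _ E'; set K := kruskal _ _.
have sE : [fset e in s] `<=` E'.
  by apply/fsubsetP => e; rewrite !in_fset mem_rcons inE orbC => ->.
have sKE := fsubsetP (kruskal_sub (edge_key w) [fset e in s]).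
have sKE' := fsubsetP (kruskal_sub (edge_key w) E').
apply/fsetP => e; rewrite in_fsetU !in_fsetD.
have [eK'|eK'] := boolP (e \in K').
  have := sKE' _ eK'; rewrite in_fset mem_rcons inE => /predU1P[<-|es].
    by rewrite eK' fset11 orbT.
  by rewrite (kruskal_stable sE _ eK') ?in_fset.
have -> : (e \in (if x \in K' then [fset x] else fset0)) = false.
  by case: ifP => xK'; rewrite inE //; apply: contraNF eK' => /eqP ->.
rewrite orbF; apply/negP => /andP[eE' /sKE es].
by rewrite (fsubsetP sE _ es) in eE'.
Qed.

Lemma accepted_kruskal w s :
  accepted kruskal_algorithm (weighted w s) =
  kruskal (edge_key w) [fset e in s].
Proof.
rewrite -[s in RHS]cat0s -run_kruskal; congr run; apply/fsetP => e.
by rewrite !inE.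
Qed.

Lemma revealed_graph_simple sigma k :
  simple_graph (revealed_graph (take k (arrivals sigma))).
Proof.
move=> e; rewrite /revealed_graph /= -map_take unzip1_weighted in_fset => es.
split; last first.
  by apply: (input_simple (i := sigma) _).2; rewrite /= in_fset (mem_take es).
apply/fsubsetP => v ve; apply/bigfcupP; exists (e, weight sigma e) => //.
by rewrite andbT map_f.
Qed.

Lemma kruskal_online : online_algorithm kruskal_algorithm.
Proof.
move=> sigma k _ /=.
have -> : accepted kruskal_algorithm (take k (arrivals sigma)) =
    kruskal (edge_key (weight sigma))
      (edges (revealed_graph (take k (arrivals sigma)))).
  by rewrite /= -map_take accepted_kruskal unzip1_weighted.
apply: spanning_forest_kruskal; first exact: edge_key_inj.
exact: revealed_graph_simple.
Qed.

Lemma kruskal_algorithm_OPT sigma : ALG kruskal_algorithm sigma = OPT sigma.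
Proof.
set S := [set total_weight sigma F | F in spanning_forest (input_graph sigma)]%classic.
have S_lb : lbound S (ALG kruskal_algorithm sigma).
  move=> _ [F sfF <-]; rewrite /ALG accepted_kruskal /total_weight.
  apply: kruskal_optimal.
  - exact: edge_key_inj.
  - exact: edge_key_le.
  - by move=> e /(input_simple (i := sigma))[].
  - by move=> e; rewrite in_fset => /weight_gt0/ltW.
  - by case: sfF.
  - by move=> u v; apply: spanning_forest_adj sfF; apply: input_simple.
have S_ALG : S (ALG kruskal_algorithm sigma).
  exists (accepted kruskal_algorithm (arrivals sigma)) => //.
  rewrite accepted_kruskal; apply: spanning_forest_kruskal.
    exact: edge_key_inj.
  exact: input_simple.
(* A lower bound of [S] that belongs to [S] is its infimum. *)
apply/eqP; rewrite eq_le; apply/andP; split.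
  by apply: lb_le_inf => //; exists (ALG kruskal_algorithm sigma).
by apply: ge_inf => //; exists (ALG kruskal_algorithm sigma).
Qed.

(** * Single-edge inputs and the lower bound *)

Lemma single_edge_simple u v : u != v ->
  simple_graph (Graph [fset u; v] [fset e in [:: [fset u; v]]]).
Proof.
by move=> uDv e; rewrite in_fset inE => /eqP ->; split; rewrite ?cardfs2 ?uDv.
Qed.

Definition single_edge_input (W : R) (W_gt0 : 0 < W) : input R :=
  @Input R [fset 0%N; 1%N] [:: [fset 0%N; 1%N]] (fun=> W) isT
    (single_edge_simple (isT : 0%N != 1%N)) (fun _ _ => W_gt0).

Lemma ALG_single_edge (A : algorithm R) (W : R) (W_gt0 : 0 < W) :
  online_algorithm A -> ALG A (single_edge_input W_gt0) = W.
Proof.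
move=> /(_ (single_edge_input W_gt0) 1%N isT) /=.
have E1 (e : edge) : [fset x in [:: e]] = [fset e].
  by apply/fsetP => x; rewrite !inE orbF.
have := @revealed_graph_simple (single_edge_input W_gt0) 1%N.
rewrite /revealed_graph /= E1 => /spanning_forest_edge/[apply].
rewrite /ALG /total_weight /= => ->.
by rewrite big_seq_fset1.
Qed.

End Online.

Theorem theorem16 (R : realType) :
  (exists A : algorithm R,
     [/\ online_algorithm A,
         strictly_competitive A 1
       & forall sigma : input R, ALG A sigma = OPT sigma]) /\
  (forall c : R, c < 1 ->
     ~ exists A : algorithm R, online_algorithm A /\ competitive A c).
Proof.
split.
  exists (@kruskal_algorithm R); split=> [|sigma|sigma].
  - exact: kruskal_online.
  - by rewrite kruskal_algorithm_OPT mul1r addr0.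
  - exact: kruskal_algorithm_OPT.
move=> c c_lt1 [A [onlA [alpha compA]]].
have c1_gt0 : 0 < 1 - c by rewrite subr_gt0.
(* For this weight [W], [(1 - c) * W] is the absolute value of [alpha] plus 1, which exceeds
   [alpha]. *)
have W_gt0 : 0 < (`|alpha| + 1) / (1 - c).
  by rewrite divr_gt0 // ltr_wpDl.
have := compA (single_edge_input W_gt0).
(* [OPT] is the cost of an online algorithm too, so one lemma evaluates both sides to [W]. *)
rewrite -kruskal_algorithm_OPT !ALG_single_edge //; last exact: kruskal_online.
rewrite -lerBlDl -{1}[X in X - _]mul1r -mulrBl mulrC divfK ?gt_eqF //.
by apply/negP; rewrite -ltNge ltr_pwDr // ler_norm.
Qed.
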